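(* Let $n\ge 1$ and $s\ge 2$ be integers, let $p$ be a prime number, and let $\mathcal F$ be a family of non-empty subsets of $[n]=\{1,\dots,n\}$. Then \[\chi(\mathrm{KG}^p(\mathcal F_{s}))\ge \left\lceil \frac{n-\alpha_1-\alpha_2}{p-1}\right\rceil,\] where $\alpha_1=(s-1)\left\lfloor \frac{n-\mathrm{ecd}^p(\mathcal F)}{p}\right\rfloor$ and $\alpha_2=\left\lfloor (p-1)\frac{n-\mathrm{ecd}^p(\mathcal F)+1}{p}\right\rfloor$.
   Context: A subset $A\subseteq[n]$ is almost $s$-stable if $|i-j|\ge s$ for all distinct $i,j\in A$. $\mathcal F_s$ denotes the set of almost $s$-stable members of $\mathcal F$. For an integer $r\ge 2$, the Kneser hypergraph $\mathrm{KG}^r(\mathcal F_s)$ is the $r$-uniform hypergraph with vertex set $\mathcal F_s$ whose edges are the sets $\{A_1,\dots,A_r\}$ of $r$ pairwise disjoint members of $\mathcal F_s$; $\chi$ denotes its chromatic number (the least number of colors in a coloring of the vertices with no monochromatic edge). For an integer $q\ge 2$, the equitable $q$-colorability defect $\mathrm{ecd}^q(\mathcal F)$ is the minimum size of a subset $X_0\subseteq[n]$ such that there is a partition $[n]\setminus X_0=X_1\cup\dots\cup X_q$ into pairwise disjoint sets with $\big||X_i|-|X_j|\big|\le 1$ for all $1\le i,j\le q$, such that there are no $F\in\mathcal F$ and $1\le i\le q$ with $F\subseteq X_i$. *)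

(* Defs.v *)
From HB Require Import structures.
From mathcomp Require Import all_boot all_order all_algebra.

Set Implicit Arguments.
Unset Strict Implicit.
Unset Printing Implicit Defensive.

(* A hypergraph is given by a finite type [V] of vertices and a set of edges
   [H : {set {set V}}]. *)

Definition monochromatic (V C : finType) (c : {ffun V -> C}) (e : {set V}) :=
  [forall u in e, forall v in e, c u == c v].

Definition colorable (V : finType) (H : {set {set V}}) (k : nat) :=
  [exists c : {ffun V -> 'I_k}, forall e in H, ~~ monochromatic c e].

(* Defaults to [#|V|] when no proper coloring exists, which requires an edge
   with fewer than two vertices; see [colorable_chi] and [chi_le]. *)
Definition chi (V : finType) (H : {set {set V}}) : nat :=
  \big[minn/#|V|]_(k < #|V|.+1 | colorable H k) k.

(* The ground set {1, ..., n} is encoded as ['I_n], i.e. shifted by one. *)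
Definition almost_stable (n s : nat) (A : {set 'I_n}) : bool :=
  [forall i in A, forall j in A,
     (i != j) ==> (s <= `|(i%:Z - j%:Z)%R|)%N].

Definition stable_part (n s : nat) (F : {set {set 'I_n}}) : {set {set 'I_n}} :=
  [set A in F | almost_stable s A].

(* The vertex set is the subtype of members of [G]. *)
Definition kneser (r n : nat) (G : {set {set 'I_n}}) :
    {set {set {A : {set 'I_n} | A \in G}}} :=
  [set e : {set {A : {set 'I_n} | A \in G}} | (#|e| == r) &&
     [forall A in e, forall B in e,
        (A != B) ==> [disjoint sval A & sval B]]].

(* [X] is an equitable partition of the complement of [X0] into [q] possibly
   empty parts, none of which contains a member of [F]. *)
Definition equitable_partition (n q : nat) (F : {set {set 'I_n}})
    (X0 : {set 'I_n}) (X : {ffun 'I_q -> {set 'I_n}}) : bool :=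
  [&& \bigcup_i X i == ~: X0,
      [forall i, forall j, (i != j) ==> [disjoint X i & X j]],
      [forall i, forall j, (`|(#|X i|%:Z - #|X j|%:Z)%R| <= 1)%N]
    & [forall A in F, forall i, ~~ (A \subset X i)]].

(* The default value [n] is irrelevant when [set0 \notin F], since then
   [X0 = setT] is admissible; see [ecd_witness] and [ecd_le]. *)
Definition ecd (n q : nat) (F : {set {set 'I_n}}) : nat :=
  \big[minn/n]_(X0 : {set 'I_n} |
                [exists X, @equitable_partition n q F X0 X]) #|X0|.

Lemma bigmin_le (I : finType) (P : pred I) (m : I -> nat) d i :
  P i -> \big[minn/d]_(j | P j) m j <= m i.
Proof.
move=> Pi; have := mem_index_enum i; rewrite unlock.
elim: (index_enum I) => //= k e IHe; rewrite inE => /predU1P[<-|/IHe le_i].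
  by rewrite Pi geq_minl.
by case: ifP => // _; rewrite geq_min le_i orbT.
Qed.

Lemma bigmin_witness (I : finType) (P : pred I) (m : I -> nat) d i :
    P i -> m i <= d ->
  exists2 j, P j & \big[minn/d]_(j | P j) m j = m j.
Proof.
move=> Pi lid; case: (arg_minnP m Pi) => j Pj minj; exists j => //.
apply/eqP; rewrite eqn_leq bigmin_le //=.
elim/big_ind: _ => [|x y lx ly|k /minj //]; last by rewrite leq_min lx.
exact: leq_trans (minj _ Pi) lid.
Qed.

Lemma colorable_card (V : finType) (H : {set {set V}}) :
  (forall e, e \in H -> 1 < #|e|) -> colorable H #|V|.
Proof.
move=> H2; apply/existsP; exists [ffun v => enum_rank v].
apply/forallP=> e; apply/implyP=> /H2/card_gt1P[u [v [ue ve uv]]].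
apply/negP=> /forallP/(_ u); rewrite ue /= => /forallP/(_ v).
by rewrite ve /= !ffunE (inj_eq enum_rank_inj) (negPf uv).
Qed.

Lemma colorable_chi (V : finType) (H : {set {set V}}) :
  (forall e, e \in H -> 1 < #|e|) -> colorable H (chi H).
Proof.
move=> /colorable_card Hc; rewrite /chi.
have [] := @bigmin_witness _ (fun k : 'I_#|V|.+1 => colorable H k)
  (fun k => k : nat) #|V| ord_max Hc (leqnn _).
by move=> k Hk ->.
Qed.

Lemma chi_le (V : finType) (H : {set {set V}}) k :
  colorable H k -> k <= #|V| -> chi H <= k.
Proof.
move=> Hk lek.
exact: (@bigmin_le _ (fun k : 'I_#|V|.+1 => colorable H k)
  (fun k => k : nat) _ (Ordinal (n := #|V|.+1) lek)).
Qed.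

Lemma ecd_le (n q : nat) (F : {set {set 'I_n}}) X0 X :
  @equitable_partition n q F X0 X -> ecd q F <= #|X0|.
Proof. by move=> HX; apply: bigmin_le; apply/existsP; exists X. Qed.

Lemma ecd_witness (n q : nat) (F : {set {set 'I_n}}) :
    set0 \notin F ->
  exists X0, exists2 X, @equitable_partition n q F X0 X & ecd q F = #|X0|.
Proof.
move=> F0.
have PT : [exists X, @equitable_partition n q F setT X].
  apply/existsP; exists [ffun=> set0]; apply/and4P; split.
  - by rewrite setCT big1 // => i _; rewrite ffunE.
  - apply/forallP=> i; apply/forallP=> j; apply/implyP=> _.
    by rewrite !ffunE -setI_eq0 setI0.
  - by apply/forallP=> i; apply/forallP=> j; rewrite !ffunE cards0.
  - apply/forallP=> A; apply/implyP=> AF; apply/forallP=> i.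
    by rewrite ffunE subset0; apply: contraNneq F0 => <-.
have [|X0 /existsP[X HX] eX] := @bigmin_witness _
  (fun X0 => [exists X, @equitable_partition n q F X0 X])
  (fun A : {set 'I_n} => #|A|) n setT PT.
  by rewrite cardsT card_ord.
by exists X0, X.
Qed.

(* Main.v *)
Require Import Defs.
From mathcomp Require Import all_boot all_order all_algebra.
From mathcomp Require Import ring lra zify.

(** The topological input is the [Z_p]-Tucker lemma.  Over ['F_p], the
    elements [tau = sh - 1] and [norm = 1 + sh + ... + sh^(p-1)] of the group
    ring generate each other's annihilators on free modules.  In the order
    complex of the nonzero words on [n] letters there are chains [h_1, h_2, ...,
    h_n], with [h_k] of length [k], such that the boundary of [h_(k+1)] is
    alternately [tau h_k] and [norm h_k].  On a complex on which ['F_p] acts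
    freely there are cochains [c_0, c_1, ...] such that the coboundary of [c_k]
    is alternately [tau c_(k+1)] and [norm c_(k+1)].  Pulling the [c_k] back
    along an equivariant labelling makes all pairings of [step c_k] with [h_k]
    equal to 1, whereas [c_n] vanishes if the target has no simplex with [n]
    vertices.

    For the theorem, a word with parts [X_g] gets the color of some stable
    member of [F] inside a part, if there is one.  Otherwise let [h] be the
    minimum over [g] of the largest size of a stable subset of [X_g].  If some
    parts exceed [h], their set [S] is labelled by [(h, #|S|)], and trimming
    stable subsets shows [p h + #|S| <= n - ecd], leaving [alpha2] levels.  If
    all parts have height exactly [h], take the least position [e] at which a
    prefix of some part already has height [h], and label by [h] and [e] modulo
    [s - 1], which gives [alpha1] levels. *)

Set Implicit Arguments.
Unset Strict Implicit.
Unset Printing Implicit Defensive.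
Import GRing.Theory Num.Theory.
Local Open Scope ring_scope.

(** * Cochains on finite sequences and the cone homotopy *)

Section Cochains.
Variable R : comNzRingType.

(** The simplicial coboundary, an alternating sum over deletions of one entry. The complex is
    augmented: the empty sequence counts as a simplex. *)
Fixpoint coboundary (T : Type) (c : seq T -> R) (t : seq T) : R :=
  if t is x :: t' then c t' - coboundary (fun u => c (x :: u)) t' else 0.

Lemma eq_coboundary_subseq (T : eqType) (c d : seq T -> R) t :
  (forall u, subseq u t -> c u = d u) -> coboundary c t = coboundary d t.
Proof.
elim: t c d => //= x t IH c d cd; congr (_ - _).
  by apply: cd; apply: (subseq_trans _ (subseq_cons t x)).
by apply: IH => u ut; apply: cd; rewrite /= eqxx.
Qed.

Lemma eq_coboundary (T : eqType) (c d : seq T -> R) : c =1 d -> coboundary c =1 coboundary d.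
Proof. by move=> cd t; apply: eq_coboundary_subseq => u _. Qed.

Lemma coboundaryB (T : eqType) (c d : seq T -> R) t :
  coboundary (fun u => c u - d u) t = coboundary c t - coboundary d t.
Proof.
elim: t c d => [|x t IH] c d /=; first by rewrite subr0.
by rewrite IH; ring.
Qed.

Lemma coboundary_sum (T : eqType) (I : finType) (c : I -> seq T -> R) t :
  coboundary (fun u => \sum_i c i u) t = \sum_i coboundary (c i) t.
Proof.
elim: t c => [|x t IH] c /=; first by rewrite big1.
by rewrite (IH (fun i u => c i (x :: u))) -sumrB.
Qed.

Lemma coboundary_map (T U : eqType) (f : T -> U) (c : seq U -> R) t :
  coboundary (fun u => c (map f u)) t = coboundary c (map f t).
Proof. by elim: t c => //= x t IH c; rewrite (IH (fun u => c (f x :: u))). Qed.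

Lemma coboundaryK (T : eqType) (c : seq T -> R) t : coboundary (coboundary c) t = 0.
Proof.
elim: t c => //= x t IH c.
by rewrite coboundaryB IH subr0 subrr.
Qed.

Section Homotopy.
Variables (T : eqType) (f : T -> T).

(** Dual to the prism operator: an alternating sum over the sequences that switch to [f] at some
    entry and keep that entry in both versions. *)
Fixpoint prism (c : seq T -> R) (t : seq T) : R :=
  if t is x :: t' then
    c (x :: f x :: map f t') - prism (fun u => c (x :: u)) t'
  else 0.

Lemma eq_prism_in (c d : seq T -> R) t :
  (forall t1 x t2, t = t1 ++ x :: t2 ->
     c (t1 ++ x :: f x :: map f t2) = d (t1 ++ x :: f x :: map f t2)) ->
  prism c t = prism d t.
Proof.
elim: t c d => //= x t IH c d cd; congr (_ - _); first exact: (cd [::]).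
by apply: IH => t1 y t2 def_t; apply: (cd (x :: t1)); rewrite def_t.
Qed.

Lemma prismB (c d : seq T -> R) t :
  prism (fun u => c u - d u) t = prism c t - prism d t.
Proof.
elim: t c d => [|x t IH] c d /=; first by rewrite subr0.
by rewrite IH; ring.
Qed.

Lemma prism_homotopy (c : seq T -> R) t :
  coboundary (prism c) t + prism (coboundary c) t = c (map f t) - c t.
Proof.
elim: t c => [|x t IH] c /=; first by rewrite addr0 subrr.
rewrite coboundaryB prismB (coboundary_map f (fun u => c (x :: f x :: u))).
have IHx := IH (fun u => c (x :: u)); simpl in IHx;
move/(canRL (addrK _)): IHx => ->.
set a := prism c t; set b := coboundary _ _; set d := prism _ _.
by ring.
Qed.

Variable e : T.

(* Dual to coning off: [X <= f X >= e] connects the identity to a constant. *)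
Definition contract (c : seq T -> R) t := c (e :: map f t) - prism c t.

Lemma contractB (c d : seq T -> R) t :
  contract (fun u => c u - d u) t = contract c t - contract d t.
Proof. by rewrite /contract prismB; ring. Qed.

(** The face of the cone opposite [e] is [map f t]; it cancels the same term of [prism_homotopy], so
    that only [c t] survives. *)
Lemma contract_homotopy (c : seq T -> R) t :
  contract (coboundary c) t = c t - coboundary (contract c) t.
Proof.
rewrite /contract /= coboundaryB (coboundary_map f (fun u => c (e :: u))).
have /(canRL (addKr _)) -> := prism_homotopy c t.
by ring.
Qed.
End Homotopy.

End Cochains.

(** * The norm and difference operators of a cyclic action *)

Section Periodic.
Variables (p : nat) (T : eqType) (sh : 'F_p -> T -> T).
Implicit Types c d : seq T -> 'F_p.

Definition norm c t : 'F_p := \sum_(a : 'F_p) c (map (sh a) t).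
Definition tau c t : 'F_p := c (map (sh 1) t) - c t.
(** Index 0 belongs to the augmentation: the boundary of [h_1] is the empty simplex, with no
    operator applied. *)
Definition step k c := if k is 0 then c else if odd k then tau c else norm c.

Lemma eq_step_in k c d t :
  (c t = d t) -> (forall a, c (map (sh a) t) = d (map (sh a) t)) ->
  step k c t = step k d t.
Proof.
move=> cd0 cd; case: k => //= k; case: ifP => _; first by rewrite /tau cd0 cd.
exact: eq_bigr.
Qed.

Lemma stepB k c d t : step k (fun u => c u - d u) t = step k c t - step k d t.
Proof.
case: k => //= k; case: ifP => _; first by rewrite /tau; ring.
by rewrite /norm sumrB.
Qed.

Lemma step_coboundary k c t : step k (coboundary c) t = coboundary (step k c) t.
Proof.
case: k => //= k; case: ifP => _.
  by rewrite /tau coboundaryB (coboundary_map (sh 1)).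
rewrite /norm (coboundary_sum (fun a u => c (map (sh a) u))).
by apply: eq_bigr => a _; rewrite (coboundary_map (sh a)).
Qed.

Hypothesis shD : forall a b x, sh (a + b) x = sh a (sh b x).

Lemma tau_norm c t : tau (norm c) t = 0.
Proof.
apply/eqP; rewrite subr_eq0 /norm; apply/eqP.
rewrite [RHS](reindex_inj (addIr 1)) /=; apply: eq_bigr => a _.
by rewrite -map_comp; congr c; apply: eq_map => x /=; rewrite shD.
Qed.

Lemma norm_tau c t : norm (tau c) t = 0.
Proof.
rewrite /norm /tau sumrB; apply/eqP; rewrite subr_eq0; apply/eqP.
rewrite [RHS](reindex_inj (addrI 1)) /=; apply: eq_bigr => a _.
by rewrite -map_comp; congr c; apply: eq_map => x /=; rewrite shD.
Qed.

Lemma step_step k c t : step k.+1 (step k.+2 c) t = 0.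
Proof. by rewrite /=; case: (odd k) => /=; rewrite ?tau_norm ?norm_tau. Qed.
End Periodic.

(** * Chains of words and evaluation on the chains [h_k] *)

Section Join.
Variables (p n : nat).
(* A word is a vertex of the barycentric subdivision of the [n]-fold join of
   ['F_p]; [None] stands for an unused coordinate. *)
Local Notation word := {ffun 'I_n -> option 'F_p}.
Implicit Types (X Y : word) (c d : seq word -> 'F_p).

Definition wshift (a : 'F_p) X : word := [ffun i => omap (+%R a) (X i)].
Definition wle X Y := [forall i : 'I_n, (X i != None) ==> (Y i == X i)].
Definition wzero : word := [ffun=> None].
(** On words supported below [k] this is the map [f] of [contract], with apex [wset k wzero]: both
    [X] and the apex lie below [wset k X]. *)
Definition wset k X : word := [ffun i : 'I_n => if (i : nat) == k then Some 0 else X i].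
Definition wsupp k X := [forall i : 'I_n, (X i != None) ==> (i < k)%N].

Lemma wleP X Y : reflect (forall i g, X i = Some g -> Y i = Some g) (wle X Y).
Proof.
apply: (iffP forallP) => [XY i g Xi | XY i].
  by have := XY i; rewrite Xi => /eqP.
by apply/implyP; case Xi: (X i) => [g|//] _; rewrite (XY i g).
Qed.

Lemma wsuppP k X : reflect (forall i g, X i = Some g -> (i < k)%N) (wsupp k X).
Proof.
apply: (iffP forallP) => [Xk i g Xi | Xk i]; first by have := Xk i; rewrite Xi.
by apply/implyP; case Xi: (X i) => [g|//] _; apply: Xk Xi.
Qed.

Lemma wneq0P X : reflect (exists i g, X i = Some g) (X != wzero).
Proof.
apply: (iffP idP) => [|[i [g Xi]]]; last first.
  by apply/eqP => X0; move: Xi; rewrite X0 ffunE.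
have [i /= Xi _|noX] := pickP [pred i | X i != None].
  by case Xi': (X i) Xi => [g|] // _; exists i, g.
by case/eqP; apply/ffunP => i; rewrite ffunE; apply/eqP/negbFE/noX.
Qed.

Lemma wshiftD a b X : wshift (a + b) X = wshift a (wshift b X).
Proof. by apply/ffunP => i; rewrite !ffunE; case: (X i) => //= g; rewrite addrA. Qed.

Lemma wshift_some a X i g : (wshift a X i == Some g) = (X i == Some (g - a)).
Proof.
rewrite ffunE; case: (X i) => //= h.
by apply/eqP/eqP => -[] => [<-|->]; congr Some; ring.
Qed.

Lemma wle_shift a X Y : wle X Y -> wle (wshift a X) (wshift a Y).
Proof.
move=> /wleP XY; apply/wleP => i g /eqP; rewrite wshift_some => /eqP/XY/eqP.
by rewrite -wshift_some => /eqP.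
Qed.

Lemma wsupp_shift a k X : wsupp k X -> wsupp k (wshift a X).
Proof.
by move=> /wsuppP Xk; apply/wsuppP => i g /eqP; rewrite wshift_some => /eqP/Xk.
Qed.

Lemma wneq0_shift a X : X != wzero -> wshift a X != wzero.
Proof.
move=> /wneq0P[i [g Xi]]; apply/wneq0P; exists i, (g + a).
by apply/eqP; rewrite wshift_some addrK Xi.
Qed.

(** Contains the support of [h_k] and is closed under shifts; repetitions are allowed. *)
Definition chain k t :=
  [&& size t == k, pairwise wle t & all (fun X => wsupp k X && (X != wzero)) t].

Lemma chain_shift a k t : chain k t -> chain k (map (wshift a) t).
Proof.
move=> /and3P[/eqP <- tP tk]; rewrite /chain size_map eqxx pairwise_map all_map /=.
apply/andP; split.
  by apply: sub_pairwise tP => X Y; apply: wle_shift.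
by apply: sub_all tk => X /andP[] /= /wsupp_shift-> /wneq0_shift->.
Qed.

Local Notation D k := (contract (wset k) (wset k wzero)).

(* Evaluation of [c] on the chain [h_k]; the chain itself is never formed. *)
Fixpoint cycle_eval k c : 'F_p :=
  if k is k'.+1 then cycle_eval k' (step wshift k' (D k' c)) else c [::].

Lemma wset_neq0 k X : (k < n)%N -> wset k X != wzero.
Proof. by move=> kn; apply/wneq0P; exists (Ordinal kn), 0; rewrite ffunE eqxx. Qed.

Lemma wsupp_set k X : wsupp k X -> wsupp k.+1 (wset k X).
Proof.
move=> /wsuppP Xk; apply/wsuppP => i g; rewrite ffunE.
by case: eqP => [-> //|_ /Xk]; apply: ltnW.
Qed.

Lemma wle_set k X Y : wle X Y -> wle (wset k X) (wset k Y).
Proof.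
by move=> /wleP XY; apply/wleP => i g; rewrite !ffunE; case: eqP => // _ /XY.
Qed.

Lemma wle_supp_set k X Y : wsupp k X -> wle X Y -> wle X (wset k Y).
Proof.
move=> /wsuppP Xk /wleP XY; apply/wleP => i g Xi; rewrite ffunE.
by case: eqP (Xk _ _ Xi) => [->|_ _]; [rewrite ltnn | apply: XY].
Qed.

Lemma wle_refl X : wle X X. Proof. exact/wleP. Qed.

Lemma wle_zero X : wle wzero X.
Proof. by apply/wleP => i g; rewrite ffunE. Qed.

Lemma wsuppS k X : wsupp k X -> wsupp k.+1 X.
Proof. by move=> /wsuppP Xk; apply/wsuppP => i g /Xk /ltnW. Qed.

Lemma chain_cone k t : (k < n)%N -> chain k t ->
  chain k.+1 (wset k wzero :: map (wset k) t).
Proof.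
move=> kn /and3P[/eqP ts tP /allP tk].
rewrite /chain /= size_map ts eqxx wset_neq0 // !all_map pairwise_map /=.
rewrite wsupp_set /=; last by apply/wsuppP => i g; rewrite ffunE.
rewrite -andbA; apply/and3P; split.
- by apply/allP => X _ /=; apply/wle_set/wle_zero.
- by apply: sub_pairwise tP => X Y; apply: wle_set.
by apply/allP => X /tk /andP[Xk _] /=; rewrite wsupp_set ?wset_neq0.
Qed.

(** Coordinate [k] is free in every word of the chain, so filling it extends each word and preserves
    the order. *)
Lemma chain_prism k t1 X t2 : (k < n)%N -> chain k (t1 ++ X :: t2) ->
  chain k.+1 (t1 ++ X :: wset k X :: map (wset k) t2).
Proof.
move=> kn /and3P[/eqP ts tP /allP tk].
have sk Y : Y \in t1 ++ X :: t2 -> wsupp k Y by move/tk/andP/proj1.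
move: ts tP; rewrite /chain !size_cat /= size_map !addnS => ->; rewrite eqxx /=.
rewrite !pairwise_cat /= !all_cat /= !allrel_consr all_map pairwise_map.
move=> /and3P[/andP[t1X t1t2] Pt1 /andP[Xt2 Pt2]].
have X0 : X \in t1 ++ X :: t2 by rewrite mem_cat inE eqxx orbT.
have st1 Y : Y \in t1 -> wsupp k Y by move=> Yt; apply: sk; rewrite mem_cat Yt.
have t2u : pairwise (relpre (wset k) wle) t2.
  by apply: sub_pairwise Pt2 => Y Z; apply: wle_set.
have Xu : all (preim (wset k) (wle X)) t2.
  by apply/allP => Y Yt /=; apply: wle_supp_set (allP Xt2 _ Yt); apply: sk.
have uXu : all (wle (wset k X)) (map (wset k) t2).
  by rewrite all_map; apply/allP => Y Yt /=; apply/wle_set/(allP Xt2).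
have t1uX : all (wle^~ (wset k X)) t1.
  by apply/allP => Y Yt; apply: wle_supp_set (allP t1X _ Yt); apply: st1.
have t1u : allrel wle t1 (map (wset k) t2).
  apply/allrelP => Y _ Yt /mapP[Z Zt ->]; apply: wle_supp_set; first exact: st1.
  exact: (allrelP t1t2).
have XuX : wle X (wset k X) by apply: wle_supp_set (wle_refl X); apply: sk.
rewrite t1X t1uX t1u Pt1 XuX Xu uXu t2u /=.
have tkS Y : Y \in t1 ++ X :: t2 -> wsupp k.+1 Y && (Y != wzero).
  by move/tk => /andP[/wsuppS-> ->].
rewrite tkS //= wset_neq0 // wsupp_set ?sk //=; apply/andP; split.
  by apply/allP => Y Yt; apply: tkS; rewrite mem_cat Yt.
rewrite all_map; apply/allP => Y Yt /=; rewrite wset_neq0 // wsupp_set ?sk //.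
by rewrite mem_cat inE Yt !orbT.
Qed.

(** Each sequence that [contract] inspects is a chain by [chain_cone] or [chain_prism], so [h_k] is
    supported on [chain k]. *)
Lemma eq_cycle_eval_in k c d : (k <= n)%N ->
  (forall t, chain k t -> c t = d t) -> cycle_eval k c = cycle_eval k d.
Proof.
elim: k c d => [|k IH] c d kn cd /=; first exact: cd.
apply: IH => [|t tk]; first exact: ltnW.
have cdD u : chain k u -> D k c u = D k d u.
  move=> uk; rewrite /contract cd ?chain_cone //; congr (_ - _).
  apply: eq_prism_in => t1 X t2 def_u; apply: cd; apply: chain_prism => //.
  by rewrite -def_u.
apply: eq_step_in => [|a]; first exact: cdD.
by apply: cdD; apply: chain_shift.
Qed.

Lemma eq_cycle_eval k c d : c =1 d -> cycle_eval k c = cycle_eval k d.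
Proof.
elim: k c d => [|k IH] c d cd /=; first exact: cd.
apply: IH => t; apply: eq_step_in => [|a];
  by rewrite /contract cd; congr (_ - _); apply: eq_prism_in => *; apply: cd.
Qed.

Lemma cycle_evalB k c d :
  cycle_eval k (fun t => c t - d t) = cycle_eval k c - cycle_eval k d.
Proof.
elim: k c d => [|k IH] c d //=.
rewrite -IH; apply: eq_cycle_eval => t; rewrite -stepB.
by apply: eq_step_in => [|a]; rewrite contractB.
Qed.

Lemma cycle_eval0 k c : c =1 (fun=> 0) -> cycle_eval k c = 0.
Proof.
move=> c0; rewrite (@eq_cycle_eval _ _ (fun t => c t - c t)).
  by rewrite cycle_evalB subrr.
by move=> t; rewrite c0 subrr.
Qed.

(** This is the formula for the boundary of [h_(k+1)]. The homotopy turns the contracted coboundary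
    into the cochain minus a coboundary, and induction handles the latter. *)
Lemma cycle_eval_coboundary k c :
  cycle_eval k.+1 (coboundary c) = cycle_eval k (step wshift k c).
Proof.
elim: k c => [|k IH] c; first by rewrite /= /contract /= subr0 subr0.
rewrite -[LHS]/(cycle_eval k.+1 (step wshift k.+1 (D k.+1 (coboundary c)))).
rewrite (@eq_cycle_eval _ _ (fun t => step wshift k.+1 c t -
   coboundary (step wshift k.+1 (D k.+1 c)) t)); last first.
  move=> t; rewrite -step_coboundary -stepB.
  by apply: eq_step_in => [|a]; rewrite contract_homotopy.
rewrite cycle_evalB IH [X in _ - X](_ : _ = 0) ?subr0 //.
(* Induction leaves two consecutive operators, which annihilate each other; for [k = 0] the outer
   one is the identity, and [tau] vanishes on the empty sequence. *)
case: k {IH} => [|k]; first by rewrite /= /tau /= subrr.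
by apply: cycle_eval0 => t; apply: step_step; apply: wshiftD.
Qed.
End Join.

(** * Alternating cochains *)

Section Alternating.
Variables (R : comNzRingType) (T : eqType).
Implicit Types (c : seq T -> R) (t u v : seq T).

(** In characteristic 2 the sign rule alone does not force vanishing on repetitions, hence the
    second clause. *)
Definition alternating c :=
  (forall u x y v, c (u ++ [:: x, y & v]) = - c (u ++ [:: y, x & v])) /\
  (forall u x v, c (u ++ [:: x, x & v]) = 0).

Lemma alternating_cons c x : alternating c -> alternating (fun t => c (x :: t)).
Proof. by case=> cS c0; split=> *; [apply: (cS (x :: _)) | apply: (c0 (x :: _))]. Qed.

Lemma coboundaryN c t : coboundary (fun u => - c u) t = - coboundary c t.
Proof. by elim: t c => [|x t IH] c /=; rewrite ?oppr0 // IH; ring. Qed.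

(** The two faces that delete one entry of the pair carry opposite signs; all other faces still
    contain the pair. *)
Lemma alternating_coboundary c : alternating c -> alternating (coboundary c).
Proof.
move=> altc; split=> u; elim: u c altc => [|a u IH] c altc x.
- move=> y v /=; rewrite !opprB !addrA.
  rewrite (@eq_coboundary _ _ _ _ (fun t => proj1 altc [::] x y t)) coboundaryN.
  by ring.
- move=> y v /=; rewrite (proj1 altc) IH; last exact: alternating_cons.
  by ring.
- move=> v /=; rewrite subKr.
  rewrite (@eq_coboundary _ _ _ (fun t => c [:: x, x & t] - c [:: x, x & t])).
    by rewrite coboundaryB subrr.
  by move=> w; rewrite (proj2 altc [::]) subrr.
move=> v /=; rewrite (proj2 altc) IH ?subrr //.
exact: alternating_cons.
Qed.

Lemma alternating_uniq c t : alternating c -> ~~ uniq t -> c t = 0.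
Proof.
elim: t c => //= x t IH c altc.
rewrite negb_and negbK => /orP[/splitPr[u v]|]; last first.
  exact/(IH (fun t => c (x :: t)))/alternating_cons.
rewrite -[_ :: _]/([::] ++ x :: u ++ x :: v).
(* The first copy of [x] moves across [u] by neighbour swaps until it meets the second. *)
elim: u [::] => [|a u IHu] w; first by rewrite (proj2 altc).
by rewrite (proj1 altc) -cat_rcons IHu oppr0.
Qed.
End Alternating.

(** * Equivariant averages of sets of signs *)

Section Barycentre.
Variable p : nat.
Implicit Types (a g : 'F_p) (S : {set 'F_p}).
Hypothesis p_pr : prime p.

(* The sum of the signs over their number: well defined modulo [p] because a
   nonempty proper subset of ['F_p] has fewer than [p] elements. *)
Definition barycentre (S : {set 'F_p}) : 'F_p := (\sum_(g in S) g) / #|S|%:R.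

Definition translate (a : 'F_p) (S : {set 'F_p}) : {set 'F_p} := [set g | g - a \in S].

Lemma translateE a S : translate a S = [set g + a | g in S].
Proof.
apply/setP => g; rewrite inE; apply/idP/imsetP => [Sg|[h Sh ->]].
  by exists (g - a); rewrite ?subrK.
by rewrite addrK.
Qed.

Lemma card_translate a S : #|translate a S| = #|S|.
Proof. by rewrite translateE card_imset //; apply: addIr. Qed.

Lemma natFp_neq0 i : (0 < i < p)%N -> i%:R != 0 :> 'F_p.
Proof.
move=> /andP[i0 ip]; rewrite -(dvdn_pcharf (pchar_Fp p_pr)).
by apply: contraL ip => /dvdn_leq; rewrite -leqNgt; apply.
Qed.

Lemma barycentre_translate a S :
  (0 < #|S| < p)%N -> barycentre (translate a S) = barycentre S + a.
Proof.
move=> /natFp_neq0 Sn0; rewrite /barycentre card_translate translateE.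
rewrite big_imset /=; last by move=> ? ? _ _; apply: addIr.
by rewrite big_split /= sumr_const -[a *+ _]mulr_natr mulrDl mulfK.
Qed.

End Barycentre.

(** * The cochains [c_k] on the complex of labels *)

Section Obstruction.
Variables (p m : nat) (kappa : nat -> nat).
Hypothesis p_pr : prime p.
Hypothesis kappa_lt : forall l, (kappa l < p)%N.
Local Notation label := ('F_p * nat)%type.
Implicit Types (t u : seq label) (b c : seq label -> 'F_p).

Definition label_shift (a : 'F_p) (v : label) : label := (v.1 + a, v.2).

Lemma label_shiftD (a b : 'F_p) v : label_shift (a + b) v = label_shift a (label_shift b v).
Proof. by rewrite /label_shift /= -addrA [b + a]addrC. Qed.

Lemma map_label_shiftD (a b : 'F_p) t : map (label_shift (a + b)) t = map (label_shift a) (map (label_shift b) t).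
Proof. by rewrite -map_comp; apply: eq_map => v /=; rewrite label_shiftD. Qed.

Lemma map_label_shift0 t : map (label_shift 0) t = t.
Proof. by apply: map_id_in => -[g l] _; rewrite /label_shift addr0. Qed.

Lemma label_shift_inj a : injective (label_shift a).
Proof.
apply: (can_inj (g := label_shift (- a))) => -[g l].
by rewrite /label_shift /= addrK.
Qed.

Definition signs t l : {set 'F_p} := [set g | (g, l) \in t].

(** The join, over the levels [l < m], of the complexes of sets of at most [kappa l] signs. *)
Definition simplex t :=
  all (fun v => v.2 < m)%N t && all (fun l => #|signs t l| <= kappa l)%N (iota 0 m).

Lemma signs_shift a t l : signs (map (label_shift a) t) l = translate a (signs t l).
Proof.
apply/setP => g; rewrite !inE -[(g, l)](_ : label_shift a (g - a, l) = _).
  by rewrite mem_map //; apply: label_shift_inj.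
by rewrite /label_shift /= subrK.
Qed.

Lemma simplex_shift a t : simplex (map (label_shift a) t) = simplex t.
Proof.
rewrite /simplex all_map; congr (_ && _).
by apply: eq_all => l; rewrite signs_shift card_translate.
Qed.

Lemma simplex_subseq u t : subseq u t -> simplex t -> simplex u.
Proof.
move=> ut /andP[/allP tm /allP tk]; apply/andP; split; apply/allP => x.
  by move=> /(mem_subseq ut)/tm.
move=> /tk; apply: leq_trans; apply/subset_leq_card/subsetP => g.
by rewrite !inE; apply: mem_subseq.
Qed.

Lemma size_simplex t : uniq t -> simplex t -> (size t <= \sum_(l < m) kappa l)%N.
Proof.
move=> tU /andP[/allP tm /allP tk].
apply: (@leq_trans (\sum_(l < m) #|signs t l|)); last first.
  by apply: leq_sum => l _; apply: tk; rewrite mem_iota /=.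
have -> : (size t = \sum_(l < m) count (fun v => v.2 == l :> nat) t)%N.
  elim: t tm {tU tk} => [|v t IH] tm /=; first by rewrite big1.
  rewrite big_split /= -IH; last by move=> w wt; apply: tm; rewrite inE wt orbT.
  have vm := tm v (mem_head _ _).
  rewrite (bigD1 (Ordinal vm)) //= eqxx big1 // => l.
  by rewrite -val_eqE /= eq_sym => /negPf->.
apply: leq_sum => l _; rewrite -size_filter.
rewrite cardE -(size_map (fun g : 'F_p => (g, l : nat))).
apply: uniq_leq_size; first exact: filter_uniq.
move=> [g l']; rewrite mem_filter /= => /andP[/eqP-> gt].
by apply: map_f; rewrite mem_enum inE.
Qed.

Definition lowest_level t := find (fun l => l \in unzip2 t) (iota 0 m).
(** An equivariant map from nonempty simplices to ['F_p], which witnesses that the action is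
    free. *)
Definition phase t := barycentre (signs t (lowest_level t)).

Lemma eq_phase t u : t =i u -> phase t = phase u.
Proof.
move=> tu; rewrite /phase; have -> : lowest_level t = lowest_level u.
  by apply: eq_find => l; apply: eq_mem_map.
by congr barycentre; apply/setP => g; rewrite !inE tu.
Qed.

Lemma phase_shift a t : t != [::] -> simplex t -> phase (map (label_shift a) t) = phase t + a.
Proof.
move=> t0 st; rewrite /phase.
have -> : lowest_level (map (label_shift a) t) = lowest_level t.
  by apply: eq_find => l; rewrite /unzip2 -map_comp.
rewrite signs_shift barycentre_translate //.
have /andP[/allP tm /allP tk] := st.
have tl : has (fun l => l \in unzip2 t) (iota 0 m).
  case: t t0 tm {st tk} => // v t _ tm; apply/hasP; exists v.2.
    by rewrite mem_iota (tm v) ?mem_head.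
  exact: mem_head.
have lm : (lowest_level t < m)%N by rewrite -(size_iota 0 m) -has_find.
apply/andP; split; last first.
  by apply: leq_ltn_trans (kappa_lt (lowest_level t)); apply: tk; rewrite mem_iota.
have /mapP[[g l] gt /= ->] : lowest_level t \in unzip2 t.
  by have := nth_find 0%N tl; rewrite nth_iota.
by apply/card_gt0P; exists g; rewrite inE.
Qed.

(** [untau] compares residues as natural numbers, so the wrap-around of [r + 1] must be explicit;
    [(Zp_trunc (pdiv p)).+2] is the size of ['F_p] by definition. *)
Lemma Fp_addr1 (r : 'F_p) :
  (r + 1 : 'F_p) = (if r.+1 == (Zp_trunc (pdiv p)).+2 then 0 else r.+1) :> nat.
Proof.
have -> : (r + 1 : 'F_p) = (r.+1 %% (Zp_trunc (pdiv p)).+2)%N :> nat.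
  by rewrite -[in RHS](addn1 r) -[RHS]modnDmr.
have [->|rq] := eqVneq r.+1 (Zp_trunc (pdiv p)).+2; first by rewrite modnn.
by rewrite modn_small // ltn_neqAle rq ltn_ord.
Qed.

Lemma Fp_ltS (r a : 'F_p) : r + 1 != 0 -> (a < (r + 1)%R)%N = (a <= r)%N.
Proof.
by have := Fp_addr1 r; case: ifP => [_ r0 /eqP[]|_ -> //]; apply: val_inj.
Qed.

Lemma Fp_max (r a : 'F_p) : r + 1 = 0 -> (a <= r)%N.
Proof.
move=> r1; have := Fp_addr1 r; rewrite r1; case: eqP => // rq _.
by rewrite -ltnS rq ltn_ord.
Qed.

(* [unnorm] and [untau] invert [norm] and [tau] on their images, taking the
   simplices of phase 0 as representatives of the orbits. *)
Definition unnorm b t : 'F_p := if phase t == 0 then b t else 0.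
Definition untau b t : 'F_p :=
  \sum_(a : 'F_p | (a < phase t)%N) b (map (label_shift (a - phase t)) t).
Definition unstep k b := if odd k then untau b else unnorm b.

Lemma norm_unnorm b t : t != [::] -> simplex t ->
  (forall a, b (map (label_shift a) t) = b t) -> norm label_shift (unnorm b) t = b t.
Proof.
move=> t0 st bt; rewrite /norm (bigD1 (- phase t)) //= /unnorm phase_shift // subrr.
rewrite eqxx bt big1 ?addr0 // => a; rewrite phase_shift // addrC addr_eq0.
by move=> /negPf->.
Qed.

(** Shifting by 1 raises the phase [r] by 1 and so adds the term [b t] to the sum. If [r + 1] wraps
    to 0, the new sum is empty, while the old one with [b t] added is the full norm, which
    vanishes. *)
Lemma tau_untau b t : t != [::] -> simplex t ->
  norm label_shift b t = 0 -> tau label_shift (untau b) t = b t.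
Proof.
move=> t0 st bt; rewrite /tau /untau phase_shift //; set r := phase t.
pose f a := b (map (label_shift (a - r)) t).
have split_r : \sum_(a : 'F_p | (a <= r)%N) f a =
    b t + \sum_(a : 'F_p | (a < r)%N) f a.
  rewrite (bigD1 r) //= /f subrr map_label_shift0; congr (_ + _).
  by apply: eq_bigl => a; rewrite ltn_neqAle andbC.
apply/eqP; rewrite subr_eq -split_r; apply/eqP.
have [r1|r1] := eqVneq (r + 1) 0; last first.
  apply: eq_big => [a|a _]; first exact: Fp_ltS.
  by rewrite -map_label_shiftD; congr (b (map (label_shift _) _)); ring.
rewrite r1 big_pred0 //; apply: etrans (esym bt) _; rewrite /norm (reindex_inj (addIr (- r))).
by apply: eq_bigl => a; rewrite Fp_max.
Qed.

Lemma swap_mem u (x y : label) v : u ++ [:: x, y & v] =i u ++ [:: y, x & v].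
Proof. by move=> z; rewrite !mem_cat !inE; congr (_ || _); apply: orbCA. Qed.

Lemma alternating_unstep k b : alternating b -> alternating (unstep k b).
Proof.
move=> [bS b0]; rewrite /unstep; case: odd.
  split=> [u x y v|u x v]; rewrite /untau.
    rewrite (eq_phase (swap_mem u x y v)) -sumrN; apply: eq_bigr => a _.
    by rewrite !map_cat /= bS.
  by rewrite big1 // => a _; rewrite map_cat /= b0.
split=> [u x y v|u x v]; rewrite /unnorm.
  by rewrite (eq_phase (swap_mem u x y v)) bS; case: eqP; rewrite ?oppr0.
by rewrite b0 if_same.
Qed.

Fixpoint obstruction k : seq label -> 'F_p :=
  if k is k'.+1 then unstep k (coboundary (obstruction k')) else
  fun t => (size t == 0%N)%:R.

Lemma alternating_obstruction k : alternating (obstruction k).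
Proof.
elim: k => [|k IH]; last by apply/alternating_unstep/alternating_coboundary.
by split=> [u x y v|u x v] /=; rewrite !size_cat !addnS ?oppr0.
Qed.

Lemma step_obstruction k t : simplex t ->
  step label_shift k.+1 (obstruction k.+1) t = coboundary (obstruction k) t.
Proof.
elim: k t => [|k IH] t st; have [->|t0] := eqVneq t [::].
- by rewrite /= /tau subrr.
(* The coboundary of [obstruction 0] is shift-invariant, so its norm is [p] times itself, which is
   zero. *)
- rewrite [LHS]/= tau_untau // /norm (eq_bigr (fun=> coboundary (obstruction 0) t)).
    by rewrite sumr_const card_Fp // -mulr_natr (pcharf0 (pchar_Fp p_pr)) mulr0.
  move=> a _; rewrite -coboundary_map; apply: eq_coboundary => u /=.
  by rewrite size_map.
- have uns0 j b : b [::] = 0 -> step label_shift j.+1 (unstep j.+1 b) [::] = 0.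
    move=> b0; rewrite /= /unstep /=; case: (odd j) => /=.
      by rewrite /norm big1 // => a _; rewrite /unnorm /= b0 if_same.
    by rewrite /tau subrr.
  by rewrite [obstruction k.+2]/= uns0.
(* The condition for inverting the next operator: by induction the left side is a coboundary of a
   coboundary. *)
have cob_step u : simplex u -> step label_shift k.+1 (coboundary (obstruction k.+1)) u = 0.
  move=> su; rewrite step_coboundary (@eq_coboundary_subseq _ _ _ (coboundary (obstruction k))).
    exact: coboundaryK.
  by move=> w wu; apply: IH; apply: simplex_subseq su.
rewrite -[obstruction k.+2]/(unstep k.+2 (coboundary (obstruction k.+1))).
move: cob_step; rewrite /unstep /=; case: (odd k) => /= h0.
  by apply: tau_untau => //; apply: h0.
apply: norm_unnorm => // a.
(* Invariance under the generator 1 is iterated to reach an arbitrary [a]. *)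
rewrite -[a]natr_Zp; elim: (val a) => [|i IHi]; first by rewrite map_label_shift0.
rewrite mulrS map_label_shiftD -IHi; apply/eqP; rewrite -subr_eq0.
by apply/eqP/h0; rewrite simplex_shift.
Qed.
End Obstruction.

(** * The [Z_p]-Tucker lemma *)

Section Tucker.
Variables (p n m : nat) (kappa : nat -> nat).
Local Notation word := {ffun 'I_n -> option 'F_p}.
Variable lab : word -> 'F_p * nat.
Hypothesis p_pr : prime p.
Hypothesis kappa_lt : forall l, (kappa l < p)%N.
Hypothesis lab_shift :
  forall a X, X != wzero p n -> lab (wshift a X) = label_shift a (lab X).
Hypothesis lab_simplex : forall t : seq word,
  pairwise (@wle p n) t -> all (fun X => X != wzero p n) t ->
  simplex m kappa (map lab t).

Let pulled k (t : seq word) := obstruction m k (map lab t).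

Lemma chain_simplex k (t : seq word) : chain k t -> simplex m kappa (map lab t).
Proof.
by move=> /and3P[_ tP tk]; apply: lab_simplex => //; apply: sub_all tk => X /andP[].
Qed.

Lemma map_lab_shift k (t : seq word) a :
  chain k t -> map lab (map (@wshift p n a) t) = map (label_shift a) (map lab t).
Proof.
move=> /and3P[_ _ /allP tk]; rewrite -!map_comp; apply/eq_in_map => X /tk /andP[_].
exact: lab_shift.
Qed.

(** The recursions of [h_k] and of [obstruction] match, so the value is the same for all [k]; at 0
    it is the value on the empty sequence. *)
Lemma cycle_eval_obstruction k :
  (k <= n)%N -> cycle_eval k (step (@wshift p n) k (pulled k)) = 1.
Proof.
elim: k => [|k IH] kn; first by rewrite /= /pulled.
rewrite -[RHS](IH (ltnW kn)) -[RHS]cycle_eval_coboundary; apply: eq_cycle_eval_in => // t tk.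
rewrite /pulled (coboundary_map lab) -(step_obstruction p_pr kappa_lt); last first.
  exact: chain_simplex tk.
rewrite [RHS]/= [LHS]/=; case: (odd k) => /=; last first.
  by rewrite /tau (map_lab_shift _ tk).
by rewrite /norm; apply: eq_bigr => a _; rewrite (map_lab_shift _ tk).
Qed.

(** With total capacity below [n], the labels of any chain of [n] words repeat, so the alternating
    cochain [obstruction n] vanishes there and its pairing with [h_n] cannot be 1. *)
Theorem Zp_tucker : (n <= \sum_(l < m) kappa l)%N.
Proof.
rewrite leqNgt; apply/negP => big_n.
have := cycle_eval_obstruction (leqnn n).
have pulled0 t : chain n t -> pulled n t = 0.
  move=> tn; rewrite /pulled; apply: alternating_uniq.
    exact: alternating_obstruction.
  apply/negP => /size_simplex /(_ (chain_simplex tn)).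
  by case/and3P: tn => /eqP tsize _ _; rewrite size_map tsize leqNgt big_n.
rewrite (@eq_cycle_eval_in _ _ _ _ (fun=> 0)) //; last first.
  move=> t tn; rewrite (@eq_step_in _ _ _ _ _ (fun=> 0 - 0)).
  - by rewrite stepB subrr.
  - by rewrite subr0 pulled0.
  by move=> a; rewrite subr0 pulled0 // chain_shift.
by rewrite cycle_eval0 // => /eqP; rewrite eq_sym oner_eq0.
Qed.
End Tucker.

(** * Stable sets and heights *)

Section StableSets.
Variables (n s : nat).
Implicit Types (A B : {set 'I_n}).

Lemma almost_stableP A :
  reflect (forall i j : 'I_n, i \in A -> j \in A -> (i < j)%N -> (i + s <= j)%N)
          (almost_stable s A).
Proof.
apply: (iffP forall_inP) => [Ast i j iA jA ij | Ast i iA].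
  have /forall_inP/(_ j jA)/implyP := Ast i iA.
  by rewrite -val_eqE neq_ltn ij => /(_ isT); lia.
apply/forall_inP => j jA; apply/implyP; rewrite -val_eqE neq_ltn.
by case/orP => ij; have := Ast _ _ _ _ ij; [move/(_ iA jA) | move/(_ jA iA)]; lia.
Qed.

Lemma almost_stableS A B : A \subset B -> almost_stable s B -> almost_stable s A.
Proof.
move=> /subsetP AB /almost_stableP Bst; apply/almost_stableP => i j /AB iB /AB.
exact: Bst.
Qed.

Definition height A := \max_(B : {set 'I_n} | (B \subset A) && almost_stable s B) #|B|.

Lemma leq_height A B : B \subset A -> almost_stable s B -> (#|B| <= height A)%N.
Proof.
move=> BA Bst; rewrite /height.
by apply: (@leq_bigmax_cond _ _ (fun B : {set 'I_n} => #|B|)); rewrite BA.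
Qed.

Lemma height_witness A :
  exists2 B : {set 'I_n}, (B \subset A) && almost_stable s B & height A = #|B|.
Proof.
have [|B BA eqB] := @eq_bigmax_cond _
  [pred B : {set 'I_n} | (B \subset A) && almost_stable s B]
  (fun B : {set 'I_n} => #|B|); last by exists B.
apply/card_gt0P; exists set0; rewrite inE sub0set; apply/almost_stableP => i j.
by rewrite inE.
Qed.

Lemma heightS A B : A \subset B -> (height A <= height B)%N.
Proof.
move=> AB; have [C /andP[CA Cst] ->] := height_witness A.
by apply: leq_height => //; apply: subset_trans AB.
Qed.

Lemma height_le A : (height A <= n)%N.
Proof.
have [B _ ->] := height_witness A.
by rewrite -[leqRHS]card_ord; apply: max_card.
Qed.

Lemma height_gt0 A i : i \in A -> (0 < height A)%N.
Proof.
move=> iA; rewrite -[1%N](cards1 i); apply: leq_height; first by rewrite sub1set.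
by apply/almost_stableP => j j'; rewrite !inE => /eqP -> /eqP ->; rewrite ltnn.
Qed.

Lemma stable_of_height A h : (h <= height A)%N ->
  exists B : {set 'I_n}, [&& B \subset A, almost_stable s B & #|B| == h].
Proof.
have [B /andP[BA Bst] ->] := height_witness A => hB.
have CB : [set i in take h (enum B)] \subset B.
  by apply/subsetP => i; rewrite inE => /mem_take; rewrite mem_enum.
exists [set i in take h (enum B)].
rewrite (subset_trans CB) // (almost_stableS CB) //= cardsE.
rewrite (card_uniqP _) ?take_uniq ?enum_uniq // size_takel // -cardE //.
Qed.

Definition upto (e : 'I_n) A := A :&: [set i : 'I_n | (i <= e)%N].

(** A largest stable subset of the prefix stays stable when [u] is added, since [u] is at distance
    at least [s] from all of it. *)
Lemma height_beyond A (e u : 'I_n) :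
  u \in A -> (e + s <= u)%N -> (0 < s)%N -> (height (upto e A) < height A)%N.
Proof.
move=> uA eu s0; have [B /andP[/subsetP BA /almost_stableP Bst] ->] := height_witness (upto e A).
have Be i : i \in B -> (i \in A) && (i <= e)%N by move/BA; rewrite !inE.
have uB : u \notin B by apply/negP => /Be; lia.
have := cardsU1 u B; rewrite uB add1n => <-; apply: leq_height.
  by rewrite subUset sub1set uA; apply/subsetP => i /Be /andP[].
apply/almost_stableP => i j; rewrite !inE => /orP[/eqP->|iB] /orP[/eqP->|jB].
- by rewrite ltnn.
- by have := Be _ jB; lia.
- by have := Be _ iB; lia.
exact: Bst.
Qed.
(** Shows later that the least position reaching a given height carries a letter. Positive height
    gives an element of [A] before [e], so [e] has a predecessor. *)
Lemma upto_pred A (e : 'I_n) : (0 < height (upto e A))%N -> e \notin A ->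
  exists2 j : 'I_n, (j < e)%N & upto e A \subset upto j A.
Proof.
have [B /andP[BA _] ->] := height_witness (upto e A).
move=> /card_gt0P[i /(subsetP BA)]; rewrite !inE => /andP[iA ie] eA.
have ne j : j \in A -> (j != e :> nat) by apply: contraTneq => /val_inj->.
have e_gt0 : (0 < e)%N by have := ne _ iA; lia.
have jn : (e.-1 < n)%N by have := ltn_ord e; lia.
exists (Ordinal jn); first by rewrite /= ltn_predL.
by apply/subsetP => j; rewrite !inE /= => /andP[jA]; rewrite jA; have := ne _ jA; lia.
Qed.
End StableSets.

(** * The equivariant labelling of words *)

Section Labelling.
Variables (n s p t : nat) (F : {set {set 'I_n}}).
Hypothesis p_pr : prime p.
Hypothesis s_ge2 : (2 <= s)%N.
Hypothesis F0 : set0 \notin F.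
Local Notation V := {A : {set 'I_n} | A \in stable_part s F}.
Variable col : V -> 'I_t.
Hypothesis col_ok : forall e, e \in kneser p (stable_part s F) ->
  exists A B, [/\ A \in e, B \in e & col A != col B].
Local Notation word := {ffun 'I_n -> option 'F_p}.
Implicit Types (X Y : word) (g h : 'F_p).

Variables alpha1 alpha2 : nat.
Hypothesis alpha1P : forall h r : nat,
  (p * h <= n - ecd p F -> 0 < h -> r < s - 1 -> (s - 1) * (h - 1) + r < alpha1)%N.
Hypothesis alpha2P : forall h j : nat,
  (p * h + j <= n - ecd p F -> 0 < j < p -> (p - 1) * h + (j - 1) < alpha2)%N.

Definition part X g := [set i | X i == Some g].

Lemma part_shift a X g : part (wshift a X) g = part X (g - a).
Proof. by apply/setP => i; rewrite !inE wshift_some. Qed.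

Lemma part_le X Y g : wle X Y -> part X g \subset part Y g.
Proof. by move=> /wleP XY; apply/subsetP => i; rewrite !inE => /eqP/XY ->. Qed.

Lemma disjoint_part X g h : g != h -> [disjoint part X g & part X h].
Proof.
move=> gh; rewrite -setI_eq0; apply/eqP/setP => i; rewrite !inE.
by apply/negP => /andP[/eqP-> /eqP[gh']]; rewrite gh' eqxx in gh.
Qed.

(** The default [n] is harmless, since heights never exceed [n]. *)
Definition min_height X := \big[minn/n]_(g : 'F_p) height s (part X g).
Definition excess X := [set g | (min_height X < height s (part X g))%N].
Definition reach X (e : 'I_n) := [exists g, (min_height X <= height s (upto e (part X g)))%N].
Definition front X := [pick e | reach X e & [forall j, reach X j ==> (e <= j)%N]].
(** Quantifying over all signs makes the choice of [A], hence its color, invariant under shifts of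
    [X]. *)
Definition contained X := [pick A : V | [exists g, sval A \subset part X g]].
Definition sign X i := odflt 0 (X i).

(* The labels of the three cases occupy the levels [alpha1 + alpha2 + _],
   [0 .. alpha2 - 1] and [alpha2 .. alpha2 + alpha1 - 1]. *)
Definition lab X : 'F_p * nat :=
  if contained X is Some A then
    (odflt 0 (omap (sign X) [pick i in sval A]), (alpha1 + alpha2 + col A)%N)
  else if excess X != set0 then
    (barycentre (excess X), ((p - 1) * min_height X + (#|excess X| - 1))%N)
  else
    (odflt 0 (omap (sign X) (front X)),
     (alpha2 + ((s - 1) * (min_height X - 1) +
                odflt 0 (omap val (front X)) %% (s - 1)))%N).

Lemma min_height_le X g : (min_height X <= height s (part X g))%N.
Proof. exact: (@bigmin_le _ predT (fun g => height s (part X g))). Qed.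

Lemma min_height_witness X : exists g, min_height X = height s (part X g).
Proof.
have [] := @bigmin_witness _ predT (fun g : 'F_p => height s (part X g)) n 0 isT.
  exact: height_le.
by move=> g _ hg; exists g.
Qed.

Lemma min_height_shift a X : min_height (wshift a X) = min_height X.
Proof.
apply/eqP; rewrite eqn_leq; apply/andP; split.
  have [g ->] := min_height_witness X.
  by rewrite -[g](addrK a) -part_shift min_height_le.
by have [g ->] := min_height_witness (wshift a X); rewrite part_shift min_height_le.
Qed.

Lemma excess_shift a X : excess (wshift a X) = translate a (excess X).
Proof. by apply/setP => g; rewrite !inE min_height_shift part_shift. Qed.

Lemma exists_shift (P : pred 'F_p) a : [exists g, P (g - a)] = [exists g, P g].
Proof.
apply/existsP/existsP => -[g Pg]; first by exists (g - a).
by exists (g + a); rewrite addrK.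
Qed.

Lemma reach_shift a X e : reach (wshift a X) e = reach X e.
Proof.
rewrite /reach -[RHS](exists_shift _ a); apply: eq_existsb => g.
by rewrite min_height_shift part_shift.
Qed.

Lemma front_shift a X : front (wshift a X) = front X.
Proof.
apply: eq_pick => e; rewrite /= reach_shift; congr (_ && _).
by apply: eq_forallb => j; rewrite reach_shift.
Qed.

Lemma contained_shift a X : contained (wshift a X) = contained X.
Proof.
apply: eq_pick => A /=; rewrite -[RHS](exists_shift _ a); apply: eq_existsb => g.
by rewrite part_shift.
Qed.

Lemma card_excess X : (#|excess X| < p)%N.
Proof.
rewrite -[ltnRHS](card_Fp p_pr) -cardsT; apply: proper_card; rewrite properT.
apply/eqP => /setP; have [g hg] := min_height_witness X.
by move=> /(_ g); rewrite !inE hg ltnn.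
Qed.

Lemma excess0 X g : excess X = set0 -> height s (part X g) = min_height X.
Proof.
move=> /setP/(_ g); rewrite !inE => /negbT; rewrite -leqNgt => hg.
by apply/eqP; rewrite eqn_leq hg min_height_le.
Qed.

Lemma min_height_gt0 X : X != wzero p n -> excess X = set0 -> (0 < min_height X)%N.
Proof.
move=> /wneq0P[i [g Xi]] /(excess0 g) <-.
by apply: (@height_gt0 _ _ _ i); rewrite inE Xi.
Qed.

Lemma frontP X : X != wzero p n -> excess X = set0 ->
  exists e g, [/\ front X = Some e, X e = Some g, (min_height X <= height s (upto e (part X g)))%N &
                  forall j, reach X j -> (e <= j)%N].
Proof.
move=> X0 eX; have h0 := min_height_gt0 X0 eX.
have [e0 re0] : exists e, reach X e.
  have /wneq0P[i [_ _]] := X0.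
  (* At the last position the prefix is the whole part, so some position is reached. *)
  have n0 : (n.-1 < n)%N by rewrite ltn_predL (leq_ltn_trans _ (ltn_ord i)).
  exists (Ordinal n0); apply/existsP; exists 0.
  rewrite -(excess0 0 eX); apply: heightS; apply/subsetP => j jX.
  by rewrite /upto in_setI jX inE /= -ltnS (ltn_predK (ltn_ord j)) ltn_ord.
have [e re emin] := arg_minnP (fun e : 'I_n => e : nat) re0.
rewrite /front; case: pickP => [e1 /andP[re1 /forall_inP emin1] | /(_ e)]; last first.
  by rewrite /= re => /negP[]; apply/forall_inP.
have [g hg] := existsP re1.
suff : e1 \in part X g by rewrite inE => /eqP Xe1; exists e1, g.
(* If [e1] lay outside the part, a shorter prefix would have the same height. *)
apply: contraT => Xe1.
have [j je sub] := upto_pred (leq_trans h0 hg) Xe1.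
have /emin1 : reach X j by apply/existsP; exists g; apply: leq_trans hg (heightS s sub).
by rewrite leqNgt je.
Qed.

Definition avoiding X := forall A, A \in stable_part s F -> forall g, ~~ (A \subset part X g).

Lemma lab_cases X : X != wzero p n ->
  [\/ exists (A : V) g, contained X = Some A /\ sval A \subset part X g
        /\ lab X = (g, (alpha1 + alpha2 + col A)%N),
      [/\ avoiding X, contained X = None, excess X != set0 & lab X =
        (barycentre (excess X), ((p - 1) * min_height X + (#|excess X| - 1))%N)] |
      [/\ avoiding X, contained X = None, excess X = set0 & exists e g,
        [/\ front X = Some e, X e = Some g, (min_height X <= height s (upto e (part X g)))%N,
            forall j, reach X j -> (e <= j)%N &
        lab X = (g, (alpha2 + ((s - 1) * (min_height X - 1) + e %% (s - 1)))%N)]]].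
Proof.
move=> X0; rewrite /lab; case mX: (contained X) => [A|]; first constructor 1.
  exists A; move: mX; rewrite /contained; case: pickP => // A' /existsP[g Ag] [<-].
  exists g; split=> //; split=> //; congr (_, _).
  case: pickP => [i iA | A0] /=.
    by move/subsetP/(_ i iA): Ag; rewrite inE /sign => /eqP->.
  have := svalP A'; rewrite inE => /andP[AF _]; case/negP: F0.
  by rewrite (_ : set0 = sval A') //; apply/setP => i; rewrite A0 inE.
have freeX : avoiding X.
  move: mX; rewrite /contained; case: pickP => // noA _ A AF g.
  by apply/negP => Ag; have /existsP[] := noA (exist _ A AF); exists g.
have [eX|eX] := eqVneq (excess X) set0; last by constructor 2.
constructor 3; split=> //; have [e [g [fe Xe re emin]]] := frontP X0 eX.
by exists e, g; split=> //; rewrite fe /= /sign Xe.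
Qed.

Lemma lab_shift a X : X != wzero p n -> lab (wshift a X) = label_shift a (lab X).
Proof.
move=> X0; have wX0 := wneq0_shift a X0.
have sgn i g : X i = Some g -> sign (wshift a X) i = g + a.
  by move=> Xi; rewrite /sign ffunE Xi /= addrC.
case: (lab_cases X0) => [[A [g [mX [Ag lX]]]]|[fX mX eX lX]|[fX mX eX]].
- case: (lab_cases wX0); rewrite contained_shift mX; try by case.
  case=> A' [g' [[<-] [Ag' ->]]]; rewrite lX /label_shift /=; congr (_, _).
  have := svalP A; rewrite inE => /andP[AF _].
  (* Any element of [A] determines the sign of the part containing [A], before and after the
     shift. *)
  have /set0Pn[i iA] : sval A != set0 by apply: contraNneq F0 => <-.
  move/subsetP/(_ i iA): Ag'; move/subsetP/(_ i iA): Ag.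
  rewrite !inE wshift_some => /eqP-> /eqP[->].
  by rewrite subrK.
- rewrite lX /lab contained_shift mX excess_shift min_height_shift card_translate.
  rewrite (_ : translate a _ != set0) /=; last by rewrite -card_gt0 card_translate card_gt0.
  by rewrite barycentre_translate // card_gt0 eX card_excess.
case=> e [g [fe Xe re emin ->]].
rewrite /lab contained_shift mX excess_shift min_height_shift front_shift fe /=.
rewrite (_ : translate a _ = set0) ?eqxx /=; last first.
  by apply/eqP; rewrite -cards_eq0 card_translate eX cards0.
by rewrite (sgn _ _ Xe).
Qed.

(* Trimming stable subsets of the parts to sizes [min_height X] and, on [excess X],
   [min_height X + 1] yields an equitable family avoiding [F]. *)
Lemma avoiding_bound X : avoiding X -> (p * min_height X + #|excess X| <= n - ecd p F)%N.
Proof.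
move=> fX.
have exY g : exists B : {set 'I_n}, [&& B \subset part X g, almost_stable s B
    & #|B| == min_height X + (g \in excess X)]%N.
  apply: stable_of_height.
  by rewrite inE; case: ltnP => [|_]; rewrite ?addn1 ?addn0 // min_height_le.
have [Y HY] := fin_all_exists exY.
have Ysub g : Y g \subset part X g by case/and3P: (HY g).
have Yst g : almost_stable s (Y g) by case/and3P: (HY g).
have Ycard g : #|Y g| = (min_height X + (g \in excess X))%N by case/and3P: (HY g) => _ _ /eqP.
have Ydisj g h : g != h -> [disjoint Y g & Y h].
  move=> /(disjoint_part X) gh; apply: disjointWl (Ysub g) _.
  exact: disjointWr (Ysub h) gh.
pose U := \bigcup_g Y g.
have cardU : #|U| = (p * min_height X + #|excess X|)%N.
  transitivity (\sum_g #|Y g|)%N.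
    rewrite /U -sum1_card partition_disjoint_bigcup //.
    by apply: eq_bigr => g _; rewrite sum1_card.
  rewrite (eq_bigr _ (fun g _ => Ycard g)) big_split /= sum_nat_const card_Fp //.
  by congr (_ + _)%N; rewrite -sum1_card [RHS]big_mkcond; apply: eq_bigr => g _; case: ifP.
(* [ecd] indexes parts by ['I_p], whose bound equals that of ['F_p] only up to a proof. *)
pose cst := cast_ord (esym (Fp_cast p_pr)).
have cst_inj : injective cst := @cast_ord_inj _ _ _.
pose Z := [ffun i : 'I_p => Y (cst i)].
have : (ecd p F <= #|~: U|)%N.
  apply: (@ecd_le _ _ _ _ Z); apply/and4P; split.
  - rewrite setCK; apply/eqP/setP => i; apply/bigcupP/bigcupP => -[g _].
      by rewrite ffunE; exists (cst g).
    exists (cast_ord (Fp_cast p_pr) g); rewrite // ffunE.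
    by rewrite [cst _](_ : _ = g) //; apply: val_inj.
  - apply/forallP => i; apply/forallP => j; apply/implyP => ij; rewrite !ffunE.
    by apply: Ydisj; rewrite (inj_eq cst_inj).
  - apply/forallP => i; apply/forallP => j; rewrite !ffunE !Ycard.
    by case: (_ \in _); case: (_ \in _); lia.
  apply/forall_inP => A AF; apply/forallP => i; rewrite ffunE; apply/negP => AY.
  (* A member of [F] inside a stable set is itself stable, so avoiding the stable members
     suffices. *)
  have := fX A; rewrite inE AF (almost_stableS AY) // => /(_ isT (cst i)) /negP[].
  exact: subset_trans AY _.
have := cardsC U; rewrite card_ord cardU; clear; lia.
Qed.

Lemma excess_level X : avoiding X -> excess X != set0 ->
  ((p - 1) * min_height X + (#|excess X| - 1) < alpha2)%N.
Proof. by move=> /avoiding_bound hX S0; apply: alpha2P; rewrite ?card_gt0 ?S0 ?card_excess. Qed.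

Lemma front_level X r : X != wzero p n -> avoiding X -> excess X = set0 ->
  (r < s - 1 -> (s - 1) * (min_height X - 1) + r < alpha1)%N.
Proof.
move=> X0 /avoiding_bound hX eX; apply: alpha1P; last exact: min_height_gt0.
exact: leq_trans (leq_addr _ _) hX.
Qed.

(** Division by [p - 1] recovers the minimal height and the size of the excess from the level. For
    equal minima the excess grows with the word, so equal sizes force equality. *)
Lemma excess_inj X Y : wle X Y -> excess X != set0 -> excess Y != set0 ->
  ((p - 1) * min_height X + (#|excess X| - 1) = (p - 1) * min_height Y + (#|excess Y| - 1))%N ->
  excess X = excess Y.
Proof.
move=> XY; rewrite -!card_gt0 => X0 Y0 eqXY.
have lt Z : (0 < #|excess Z|)%N -> (#|excess Z| - 1 < p - 1)%N.
  by have := card_excess Z; clear; lia.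
have div Z : (0 < #|excess Z|)%N ->
    ((p - 1) * min_height Z + (#|excess Z| - 1) = min_height Z * (p - 1) + (#|excess Z| - 1))%N.
  by rewrite mulnC.
have p1 : (0 < p - 1)%N by have := prime_gt1 p_pr; clear; lia.
have hXY : min_height X = min_height Y.
  have := congr1 (divn^~ (p - 1)%N) eqXY.
  by rewrite !(mulnC (p - 1)%N) !divnMDl // !divn_small ?lt // !addn0.
apply/eqP; rewrite eqEcard; apply/andP; split.
  apply/subsetP => g; rewrite !inE -hXY => /leq_trans; apply.
  exact/heightS/part_le.
by move: eqXY X0 Y0; rewrite hXY; clear; lia.
Qed.

(* If the sign changed, the front would move left by at least [s - 1]; then an
   old letter [h] to the right of [e] lies [s] beyond the new front [f] and
   raises the height of part [h]. *)
Lemma front_inj X Y e f g h : wle X Y -> excess X = set0 -> excess Y = set0 ->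
    X != wzero p n ->
    X e = Some g -> Y f = Some h ->
    (min_height X <= height s (upto e (part X g)))%N -> (forall j, reach X j -> (e <= j)%N) ->
    (min_height Y <= height s (upto f (part Y h)))%N -> (forall j, reach Y j -> (f <= j)%N) ->
  ((s - 1) * (min_height X - 1) + e %% (s - 1) = (s - 1) * (min_height Y - 1) + f %% (s - 1))%N ->
  g = h.
Proof.
move=> XY eX eY X0 Xe Yf rXe eminX rYf fminY eq_lev.
have Y0 : Y != wzero p n.
  by move/wneq0P: X0 => [i [k Xi]]; apply/wneq0P; exists i, k; move/wleP: XY; apply.
have hX0 := min_height_gt0 X0 eX; have hY0 := min_height_gt0 Y0 eY.
have s1 : (0 < s - 1)%N by rewrite subn_gt0.
have hXY : min_height X = min_height Y.
  have := congr1 (divn^~ (s - 1)%N) eq_lev.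
  by rewrite !(mulnC (s - 1)%N) !divnMDl // !divn_small ?ltn_mod // !addn0; clear -hX0 hY0; lia.
have ef : (e = f %[mod s - 1])%N by move: eq_lev; rewrite hXY => /addnI.
have fe : (f <= e)%N.
  apply: fminY; apply/existsP; exists g.
  rewrite -hXY; apply: leq_trans rXe _; apply/heightS/setSI; exact: part_le.
have Ye : Y e = Some g by move/wleP: XY; apply.
have [fe_eq|fe_neq] := eqVneq f e.
  by move: Yf; rewrite fe_eq Ye => -[].
have fe_far : (f + (s - 1) <= e)%N.
  have ltfe : (f < e)%N by rewrite ltn_neqAle fe andbT.
  move/eqP: ef; rewrite eqn_mod_dvd // => /dvdn_leq; clear -ltfe; lia.
have [//|gh] := eqVneq g h; exfalso.
(* Otherwise part [h] of [X] ends before [e], and the minimal height would be reached to the left of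
   [e]. *)
have [u Xu eu] : exists2 u : 'I_n, X u = Some h & (e < u)%N.
  have [u /andP[/eqP Xu eu] | noU] := pickP [pred u | (X u == Some h) & (e < u)%N].
    by exists u.
  have eh : e \notin part X h by rewrite inE Xe; apply: contra_neqN gh => /eqP[].
  have sub_e : part X h \subset upto e (part X h).
    apply/subsetP => j Xj; rewrite /upto in_setI Xj inE leqNgt.
    by have := noU j; rewrite inE in Xj; rewrite /= Xj /= => ->.
  have he : (min_height X <= height s (upto e (part X h)))%N.
    by rewrite -(excess0 h eX); apply: heightS.
  have [j je sub] := upto_pred (leq_trans hX0 he) eh.
  have /eminX : reach X j by apply/existsP; exists h; apply: leq_trans he (heightS s sub).
  by rewrite leqNgt je.
have Yu : u \in part Y h by rewrite inE; move/wleP: XY => /(_ _ _ Xu) ->.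
(* The strict [e < u] supplies the unit missing from [s - 1]. *)
have fu : (f + s <= u)%N by clear -s_ge2 fe_far eu; lia.
have := height_beyond Yu fu (ltnW s_ge2).
by rewrite (excess0 h eY) ltnNge rYf.
Qed.

Lemma lab_spec X : X != wzero p n ->
  [\/ exists2 A : V, sval A \subset part X (lab X).1 &
        (lab X).2 = (alpha1 + alpha2 + col A)%N,
      [/\ excess X != set0, (lab X).1 = barycentre (excess X),
          (lab X).2 = ((p - 1) * min_height X + (#|excess X| - 1))%N &
          ((lab X).2 < alpha2)%N] |
      [/\ excess X = set0, (alpha2 <= (lab X).2 < alpha1 + alpha2)%N &
        exists e, [/\ X e = Some (lab X).1,
          (min_height X <= height s (upto e (part X (lab X).1)))%N,
          forall j, reach X j -> (e <= j)%N &
          (lab X).2 = (alpha2 + ((s - 1) * (min_height X - 1) + e %% (s - 1)))%N]]].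
Proof.
move=> X0; case: (lab_cases X0).
- by case=> A [g [_ [Ag ->]]]; constructor 1; exists A.
- case=> fX _ eX ->; constructor 2; split=> //=.
  exact: excess_level.
case=> fX _ eX [e [g [_ Xe he emin ->]]]; constructor 3; split=> //=.
  rewrite leq_addr [(alpha1 + _)%N]addnC ltn_add2l; apply: front_level => //.
  by rewrite ltn_mod subn_gt0.
by exists e.
Qed.

Lemma lab_lt X : X != wzero p n -> ((lab X).2 < alpha1 + alpha2 + t)%N.
Proof.
case/lab_spec => [[A _ ->]|[_ _ _ lt2]|[_ /andP[_ lt12] _]].
- by rewrite ltn_add2l.
- by apply: leq_trans lt2 _; rewrite -addnA addnCA leq_addr.
by apply: leq_trans lt12 _; rewrite leq_addr.
Qed.

Lemma lab_color X : X != wzero p n -> (alpha1 + alpha2 <= (lab X).2)%N ->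
  exists2 A : V, sval A \subset part X (lab X).1 &
                 (lab X).2 = (alpha1 + alpha2 + col A)%N.
Proof.
case/lab_spec => [//|[_ _ _ lt2]|[_ /andP[_ lt12] _]].
  by rewrite leqNgt ltn_addl.
by rewrite leqNgt lt12.
Qed.

(** This gives capacity 1 below the color levels. The cases occupy disjoint intervals of levels, so
    only words of the same case need comparison. *)
Lemma lab_small X Y : wle X Y -> X != wzero p n -> Y != wzero p n ->
  (lab X).2 = (lab Y).2 -> ((lab X).2 < alpha1 + alpha2)%N -> (lab X).1 = (lab Y).1.
Proof.
move=> XY X0 Y0 eqXY l_lt; have l_ltY := l_lt; rewrite eqXY in l_ltY.
case: (lab_spec X0) => [[A _ lX]|[eX sX lX ltX]|[eX /andP[geX _] [e [Xe he emin lX]]]].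
- by exfalso; move: l_lt; rewrite lX ltnNge leq_addr.
- case: (lab_spec Y0) => [[A _ lY]|[eY sY lY _]|[_ /andP[geY _] _]].
  + by exfalso; move: l_ltY; rewrite lY ltnNge leq_addr.
  + by rewrite sX sY; congr barycentre; apply: excess_inj XY eX eY _; rewrite -lX eqXY.
  by exfalso; move: geY; rewrite -eqXY leqNgt ltX.
case: (lab_spec Y0) => [[A _ lY]|[_ _ _ ltY]|[eY _ [f [Yf hf fmin lY]]]].
- by exfalso; move: l_ltY; rewrite lY ltnNge leq_addr.
- by exfalso; move: geX; rewrite eqXY leqNgt ltY.
apply: (front_inj XY eX eY X0 Xe Yf) => //.
by apply: (@addnI alpha2); rewrite -lX -lY.
Qed.

(** Disjoint non-empty sets are distinct, so [W] has exactly [p] values. *)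
Lemma rainbow_edge (W : 'F_p -> V) :
  (forall g h, g != h -> [disjoint sval (W g) & sval (W h)]) ->
  [set W g | g : 'F_p] \in kneser p (stable_part s F).
Proof.
move=> Wdisj; have W_inj : injective W.
  move=> g h gh; apply/eqP/negPn/negP => /Wdisj; rewrite gh -setI_eq0 setIid.
  have := svalP (W h); rewrite inE => /andP[WF _] /eqP W0.
  by rewrite W0 (negPf F0) in WF.
rewrite inE card_imset // card_Fp // eqxx; apply/forall_inP => _ /imsetP[g _ ->].
apply/forall_inP => _ /imsetP[h _ ->]; apply/implyP => gh.
by apply: Wdisj; apply: contraNneq gh => ->.
Qed.

(** At a color level, all [p] signs together would produce a monochromatic edge. *)
Definition capacity l := (if (l < alpha1 + alpha2)%N then 1 else p - 1)%N.

Lemma lab_simplex (w : seq word) : pairwise (@wle p n) w ->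
  all (fun X => X != wzero p n) w ->
  simplex (alpha1 + alpha2 + t) capacity (map lab w).
Proof.
move=> wP /allP w0; apply/andP; split.
  by rewrite all_map; apply/allP => X /w0 /=; apply: lab_lt.
have cmp X Y : X \in w -> Y \in w -> wle X Y \/ wle Y X.
  move=> Xw Yw; have /(pairwiseP (wzero p n)) wP' := wP.
  rewrite -(nth_index (wzero p n) Xw) -(nth_index (wzero p n) Yw).
  have [ij|ij|->] := ltngtP (index X w) (index Y w).
  - by left; apply: wP'; rewrite ?inE ?index_mem.
  - by right; apply: wP'; rewrite ?inE ?index_mem.
  by left; apply: wle_refl.
apply/allP => l _; rewrite /capacity; case: ltnP => l_lt.
  apply/card_le1_eqP => g h; rewrite !inE.
  move=> /mapP[X Xw lX] /mapP[Y Yw lY].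
  have -> : g = (lab X).1 by rewrite -lX.
  have -> : h = (lab Y).1 by rewrite -lY.
  have lXY : (lab X).2 = (lab Y).2 by rewrite -lX -lY.
  have lXlt : ((lab X).2 < alpha1 + alpha2)%N by rewrite -lX.
  have [X0 Y0] := (w0 X Xw, w0 Y Yw).
  case: (cmp X Y Xw Yw) => XY; first exact/esym/(lab_small XY X0 Y0 lXY lXlt).
  by apply: (lab_small XY Y0 X0 (esym lXY)); rewrite -lXY.
suff lt_p : (#|signs (map lab w) l| < p)%N.
  by rewrite -ltnS subn1 prednK ?prime_gt0.
rewrite ltnNge; apply/negP => all_signs.
have sT g : (g, l) \in map lab w.
  have /eqP : signs (map lab w) l == setT.
    by rewrite eqEcard subsetT cardsT card_Fp.
  by move/setP/(_ g); rewrite !inE.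
have exX g : exists X : word, (X \in w) && (lab X == (g, l)).
  by have /mapP[X Xw lX] := sT g; exists X; rewrite Xw -lX eqxx.
have [X HX] := fin_all_exists exX.
have Xw g : X g \in w by case/andP: (HX g).
have exA g : exists A : V, (sval A \subset part (X g) g) &&
    (l == alpha1 + alpha2 + col A)%N.
  have /andP[_ /eqP lX] := HX g.
  have := lab_color (w0 _ (Xw g)); rewrite lX /= => /(_ l_lt) [A Ag /eqP cA].
  by exists A; rewrite Ag cA.
have [W HW] := fin_all_exists exA.
have Wdisj g h : g != h -> [disjoint sval (W g) & sval (W h)].
  move=> gh; have /andP[Wg _] := HW g; have /andP[Wh _] := HW h.
  (* Both sets lie in parts of the larger of the two words, where distinct signs have disjoint
     parts. *)
  case: (cmp _ _ (Xw g) (Xw h)) => [/(part_le g) Xgh|/(part_le h) Xgh].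
    apply: disjointWl (subset_trans Wg Xgh) _; apply: disjointWr Wh _.
    exact: disjoint_part.
  apply: disjointWl Wg _; apply: disjointWr (subset_trans Wh Xgh) _.
  exact: disjoint_part.
have [A [B [/imsetP[g _ ->] /imsetP[h _ ->]]]] := col_ok (rainbow_edge Wdisj).
have /andP[_ /eqP cg] := HW g; have /andP[_ /eqP ch] := HW h.
by rewrite -val_eqE -(eqn_add2l (alpha1 + alpha2)) /= -cg -ch eqxx.
Qed.

Lemma coloring_bound : (n <= alpha1 + alpha2 + t * (p - 1))%N.
Proof.
have cap_lt l : (capacity l < p)%N.
  by rewrite /capacity subn1; case: ifP; rewrite ?prime_gt1 ?prednK ?prime_gt0.
have lsh a X : X != wzero p n -> lab (wshift a X) = label_shift a (lab X).
  exact: lab_shift.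
apply: leq_trans (Zp_tucker p_pr cap_lt lsh lab_simplex) _.
rewrite big_split_ord /=; apply: leq_add.
  rewrite (eq_bigr (fun=> 1)%N) ?sum_nat_const ?card_ord ?muln1 // => i _.
  by rewrite /capacity ltn_ord.
rewrite (eq_bigr (fun=> p - 1)%N) ?sum_nat_const ?card_ord // => i _.
by rewrite /capacity ltnNge leq_addr.
Qed.
End Labelling.

(** * Arithmetic of the level counts and the chromatic bound *)

Theorem theorem2 (n s p : nat) (F : {set {set 'I_n}}) :
  (1 <= n)%N -> (2 <= s)%N -> prime p -> set0 \notin F ->
  let alpha1 := ((s - 1) * ((n - ecd p F) %/ p))%N in
  let alpha2 := (((p - 1) * (n - ecd p F + 1)) %/ p)%N in
  ((Num.ceil ((n%:R - alpha1%:R - alpha2%:R) / (p - 1)%N%:R : rat)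
     <= (chi (kneser p (stable_part s F)))%:Z)%R : Prop).
Proof.
move=> _ s_ge2 p_pr F0 alpha1 alpha2; have p1 := prime_gt1 p_pr.
have edge2 e : e \in kneser p (stable_part s F) -> (1 < #|e|)%N.
  by rewrite inE => /andP[/eqP->].
have /existsP[col /forall_inP col_proper] := colorable_chi edge2.
have col_ok e : e \in kneser p (stable_part s F) ->
    exists A B, [/\ A \in e, B \in e & col A != col B].
  move/col_proper/forall_inPn => [A Ae /forall_inPn[B Be AB]].
  by exists A, B.
have alpha1P h r : (p * h <= n - ecd p F -> 0 < h -> r < s - 1 ->
    (s - 1) * (h - 1) + r < alpha1)%N.
  move=> hp h0 rs; have : (h <= (n - ecd p F) %/ p)%N.
    by rewrite leq_divRL ?prime_gt0 // mulnC.
  rewrite /alpha1; move: (_ %/ _)%N => k hk; clear -h0 rs hk.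
  apply: leq_trans (leq_mul (leqnn _) hk).
  by case: h h0 {hk} => // h _; rewrite subSS subn0 mulnS addnC ltn_add2r.
have alpha2P h j : (p * h + j <= n - ecd p F -> 0 < j < p ->
    (p - 1) * h + (j - 1) < alpha2)%N.
  (* With [a >= p * h + j], the product [(p - 1) * (a + 1)] is at least [p * ((p - 1) * h + j)]
     because [j <= p - 1]. *)
  rewrite /alpha2 leq_divRL ?(ltnW p1) //; move: (n - ecd p F)%N => a.
  clear; case: p => [|q] ha /andP[j0 jq] //; rewrite subSS subn0.
  nia.
have := coloring_bound p_pr s_ge2 F0 col_ok alpha1P alpha2P.
move: (chi _) (alpha1) (alpha2) => k a1 a2 bound.
rewrite ceil_le_int ler_pdivrMr; last by rewrite ltr0n subn_gt0.
rewrite -[k%:Z%:~R]/(k%:R) -natrM !lerBlDr -!natrD ler_nat.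
by rewrite -addnA addnC [(a2 + a1)%N]addnC.
Qed.
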